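(* Let $A$ be a regular system of divisors, $f:\mathbb N\to\mathbb C$ an arbitrary function, and $n,k\in\mathbb N$. Then \[ \sum_{j=1}^n f\big((j,n)_A\big)\,\zeta_n^{jk}=\sum_{d\in A((k,n)_A)} d\,(\mu_A*_Af)(n/d), \] where the sum on the right is over the divisors $d$ of $n$ with $d\mid k$ and $d\in A(n)$.
   Context: A regular system of divisors is a family $A=(A(n))_{n\in\mathbb N}$, where each $A(n)$ is a set of positive divisors of $n$, such that: (i) $A(1)=\{1\}$ and $A(mn)=\{de: d\in A(m), e\in A(n)\}$ whenever $\gcd(m,n)=1$; (ii) for every prime power $p^a$ ($a\ge1$) there is a divisor $t=t_A(p^a)$ of $a$ such that $A(p^{it})=\{1,p^t,\dots,p^{it}\}$ for every $0\le i\le a/t$. The $A$-convolution of $f,g:\mathbb N\to\mathbb C$ is $(f*_Ag)(n)=\sum_{d\in A(n)}f(d)g(n/d)$; $\mu_A$ is the $*_A$-inverse of the constant function $1$. For $j\in\mathbb Z$, $(j,n)_A=\max\{d\in\mathbb N: d\mid j,\ d\in A(n)\}$; $\zeta_n=e^{2\pi i/n}$. *)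

(* Defs.v *)
From HB Require Export structures.
From mathcomp Require Export all_boot all_order all_algebra finmap.
From mathcomp Require Export all_classical reals topology normedtype sequences.
From mathcomp Require Export exp trigo.
From mathcomp Require Export complex.

Set Implicit Arguments.
Unset Strict Implicit.
Unset Printing Implicit Defensive.

Import Order.TTheory GRing.Theory Num.Theory.

Local Open Scope ring_scope.

(* The positive integers are represented by the n : nat with 0 < n; values at
   0 (of A, or of an arithmetical function) are junk and never constrained. *)
Record regular_divisor_system (A : nat -> {fset nat}) : Prop :=
  RegularDivisorSystem {
    rds_dvd : forall n d : nat, (0 < n)%N -> d \in A n -> (d %| n)%N;
    rds_1 : A 1%N = [fset 1%N]%fset;
    rds_mul : forall m n : nat, (0 < m)%N -> (0 < n)%N -> coprime m n ->
      A (m * n)%N = [fset (d * e)%N | d in A m, e in A n]%fset;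
    rds_primepow : forall p a : nat, prime p -> (0 < a)%N ->
      exists2 t : nat, (t %| a)%N &
        forall i : nat, (i <= a %/ t)%N ->
          A (p ^ (i * t))%N = [fset (p ^ (j * t))%N | j in iota 0 i.+1]%fset
  }.

Definition Agcd (A : nat -> {fset nat}) (j : int) (n : nat) : nat :=
  \max_(d <- A n | (d %| j)%Z) d.

Definition Aconv (R : realType) (A : nat -> {fset nat})
    (f g : nat -> R[i]) (n : nat) : R[i] :=
  \sum_(d <- A n) f d * g (n %/ d)%N.

(* The identity for the convolution is the indicator of 1. *)
Definition Ainverse (R : realType) (A : nat -> {fset nat})
    (f g : nat -> R[i]) : Prop :=
  forall n : nat, (0 < n)%N ->
    Aconv A f g n = (n == 1%N)%:R /\ Aconv A g f n = (n == 1%N)%:R.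

(* The default value is irrelevant: when A is regular an inverse of 1 exists,
   and any two inverses agree at the positive integers. *)
Definition Amu (R : realType) (A : nat -> {fset nat}) : nat -> R[i] :=
  xget (fun=> 0) [set g | Ainverse A (fun=> 1) g]%classic.

Definition Cexp (R : realType) (z : R[i]) : R[i] :=
  (expR (complex.Re z))%:C%C *
  (cos (complex.Im z) +i* sin (complex.Im z))%C.

Definition zeta (R : realType) (n : nat) : R[i] :=
  Cexp (2 * (pi : R)%:C%C * 'i%C / n%:R).

(* Main.v *)
Require Import Defs.

(** Membership [d \in A n] can be tested prime by prime, where [A (p ^ a)] is a
    chain of powers of [p ^ t]. Hence [A n] is closed under complementary
    divisors and lcm, and [A d] consists of the [e \in A n] dividing [d] whenever
    [d \in A n]; in particular [A (k, n)_A] is the set of [d \in A n] dividing [k].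
    Writing [F] for the convolution of [mu_A] and [f], Moebius inversion gives
    [f (j, n)_A] as the sum of [F d] over the [d \in A n] dividing [j]. After
    exchanging sums, the inner sum of [zeta_n ^ (j k)] over the multiples [j] of
    [d] is geometric: it is [n / d] if [n / d] divides [k] and [0] otherwise, and
    replacing [d] by [n / d] gives the right-hand side. *)

Set Implicit Arguments.
Unset Strict Implicit.
Unset Printing Implicit Defensive.

Import Order.TTheory GRing.Theory Num.Theory.
Local Open Scope ring_scope.

(** * Local description and closure properties of [A n], and the [A]-gcd *)

Section RegularDivisorSystem.
Local Open Scope nat_scope.

Variables (A : nat -> {fset nat}) (hA : regular_divisor_system A).

(** A single [t] serves [p ^ a] and the lower [p ^ b] with [t %| b], so that [A n] and [A d] can be
    compared at each prime. *)
Lemma rds_primepow_mem p a : prime p ->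
  exists2 t, t %| a & forall b c, b <= a -> t %| b ->
    (p ^ c \in A (p ^ b)) = (t %| c) && (c <= b).
Proof.
move=> pp; have [->|a0] := posnP a.
  exists 1 => // b c; rewrite leqn0 => /eqP-> _.
  by rewrite expn0 rds_1// inE dvd1n leqn0 -(expn0 p) eqn_exp2l ?prime_gt1.
have [t ta H] := rds_primepow hA pp a0; exists t => // b c ba tb.
have t0 : 0 < t by apply: dvdn_gt0 ta.
rewrite -{1}(divnK tb) H ?leq_div2r//; apply/imfsetP/andP.
- move=> [j jI /eqP]; have jb : j <= b %/ t.
    by have : j \in iota 0 (b %/ t).+1 by []; rewrite mem_iota.
  rewrite eqn_exp2l ?prime_gt1// => /eqP->; split; first exact: dvdn_mull.
  by rewrite -leq_divRL.
- move=> [tc cb]; exists (c %/ t); last by rewrite divnK.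
  change (c %/ t \in iota 0 (b %/ t).+1).
  by rewrite mem_iota add0n ltnS leq_div2r.
Qed.

(** Strong induction: multiplicativity splits off the part of [n] at its least prime factor, and the
    remaining coprime part is smaller than [n]. *)
Lemma rds_mem_log n d : 0 < n ->
  d \in A n <->
  0 < d /\ forall p, prime p -> p ^ logn p d \in A (p ^ logn p n).
Proof.
elim/ltn_ind: n d => n IH d n0; have [n1|n1] := leqP n 1.
  have -> : n = 1 by apply/eqP; rewrite eqn_leq n1.
  rewrite rds_1// inE; split=> [/eqP->|[d0 H]].
    by split=> // p _; rewrite logn1 rds_1// inE.
  apply/eqP/eqn_from_log => // p; rewrite logn1.
  have [pp|/negbTE pp] := boolP (prime p); last by rewrite lognE pp.
  have := H p pp; rewrite logn1 rds_1// inE -[X in _ == X](expn0 p).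
  by rewrite eqn_exp2l ?prime_gt1// => /eqP.
pose p := pdiv n; have pp : prime p by exact: pdiv_prime.
have r0 : 0 < n`_p^' by exact: part_gt0.
have m0 : 0 < n`_p by exact: part_gt0.
have rn : n`_p^' < n.
  rewrite -[X in _ < X](partnC p n0) -[X in X < _]mul1n ltn_pmul2r//.
  by rewrite p_part -(expn0 p) ltn_exp2l ?prime_gt1// logn_gt0 mem_primes pp n0
     pdiv_dvd.
have logp m : 0 < m -> logn p m`_p^' = 0.
  by move=> ?; apply: logn_coprime; rewrite prime_coprime -?p'natE ?part_pnat.
have logq q m : 0 < m -> q != p -> logn q m`_p^' = logn q m.
  move=> mg qp; rewrite -[in RHS](partnC p mg) lognM ?part_gt0// p_part.
  have [pq|/negbTE pq] := boolP (prime q); last first.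
    by have log0 x : logn q x = 0 by [rewrite lognE pq]; rewrite !log0.
  by rewrite lognX (@logn_prime q p)// (negbTE qp) muln0.
rewrite -{1}(partnC p n0) rds_mul ?coprime_partC//.
split.
- case/imfset2P => d1 /= d1A [d2 /= d2A ->].
  have d1n := rds_dvd hA m0 d1A; have d2n := rds_dvd hA r0 d2A.
  have d10 := dvdn_gt0 m0 d1n; have d20 := dvdn_gt0 r0 d2n.
  split; first by rewrite muln_gt0 d10.
  move=> q pq; rewrite lognM//.
  (* As a divisor of a power of [p], [d1] contributes to the exponent at [p] only. *)
  move: (d1n); rewrite p_part => /(dvdn_pfactor _ _ pp)[b _ d1E].
  have [->|qp] := eqVneq q p.
    have := dvdn_leq_log p r0 d2n; rewrite logp// leqn0 => /eqP->.
    by rewrite addn0 d1E pfactorK// -d1E -p_part.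
  rewrite d1E lognX (@logn_prime q p)// (negbTE qp) muln0 add0n -(logq q n)//.
  exact: (((IH _ rn d2 r0).1 d2A).2 q pq).
- move=> [d0 H]; apply/imfset2P; exists d`_p => /=.
    by rewrite !p_part H.
  exists d`_p^'; last by rewrite partnC.
  apply/(IH _ rn _ r0); split; first exact: part_gt0.
  move=> q pq; have [->|qp] := eqVneq q p; last by rewrite !logq ?H.
  (* At [p] itself both exponents vanish and the condition reads [1 \in A 1]. *)
  by rewrite !logp// rds_1// inE.
Qed.

Lemma rds_gt0 n d : 0 < n -> d \in A n -> 0 < d.
Proof. by move=> n0 /(rds_dvd hA n0); exact: dvdn_gt0. Qed.

Lemma rds_id n : 0 < n -> n \in A n.
Proof.
move=> n0; apply/rds_mem_log => //; split=> // p pp.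
by have [t ta ->] := rds_primepow_mem (logn p n) pp; rewrite ?ta /=.
Qed.

Lemma rds_mem1 n : 0 < n -> 1 \in A n.
Proof.
move=> n0; apply/rds_mem_log => //; split=> // p pp.
by have [t ta ->] := rds_primepow_mem (logn p n) pp; rewrite ?logn1 ?dvdn0.
Qed.

(** At each prime the exponents of [n] and [d] are multiples of the same [t], hence so is their
    difference. *)
Lemma rds_codiv n d : 0 < n -> d \in A n -> n %/ d \in A n.
Proof.
move=> n0 dA; have dn := rds_dvd hA n0 dA.
have d0 := dvdn_gt0 n0 dn.
apply/rds_mem_log => //; split; first by rewrite divn_gt0// dvdn_leq.
move=> p pp; have := ((rds_mem_log d n0).1 dA).2 p pp.
have [t ta H] := rds_primepow_mem (logn p n) pp.
rewrite !H// logn_div// => /andP[td le].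
by rewrite dvdn_sub//= leq_subr.
Qed.

(** The [t] of [n] at a prime also governs [d], since [d \in A n]; only the upper bounds on the
    exponents differ, and these amount to divisibility. *)
Lemma rds_mem_sub n d e : 0 < n -> d \in A n ->
  (e \in A d) = (e \in A n) && (e %| d).
Proof.
move=> n0 dA; have dn := rds_dvd hA n0 dA; have d0 := dvdn_gt0 n0 dn.
have key p : prime p -> exists2 t, t %| logn p d &
    (forall c, (p ^ c \in A (p ^ logn p n)) = (t %| c) && (c <= logn p n)) /\
    (forall c, (p ^ c \in A (p ^ logn p d)) = (t %| c) && (c <= logn p d)).
  move=> pp; have := ((rds_mem_log d n0).1 dA).2 p pp.
  have [t ta H] := rds_primepow_mem (logn p n) pp.
  rewrite H// => /andP[td le]; exists t => //.
  by split=> c; rewrite H.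
apply/idP/andP => [eA|[eA ed]].
- have ed := rds_dvd hA d0 eA; split=> //; have e0 := dvdn_gt0 d0 ed.
  apply/rds_mem_log => //; split=> // p pp.
  have := ((rds_mem_log e d0).1 eA).2 p pp.
  have [t td [-> ->]] := key p pp => /andP[-> le] /=.
  exact: leq_trans le (dvdn_leq_log _ n0 dn).
- have e0 := dvdn_gt0 d0 ed; apply/rds_mem_log => //; split=> // p pp.
  have := ((rds_mem_log e n0).1 eA).2 p pp.
  have [t td [-> ->]] := key p pp => /andP[-> _] /=.
  exact: dvdn_leq_log.
Qed.

(** At each prime the lcm has the exponent of [d] or that of [e]. *)
Lemma rds_lcm n d e : 0 < n -> d \in A n -> e \in A n -> lcmn d e \in A n.
Proof.
move=> n0 dA eA; have d0 := rds_gt0 n0 dA; have e0 := rds_gt0 n0 eA.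
apply/rds_mem_log => //; split=> [|p pp]; first by rewrite lcmn_gt0 d0.
rewrite logn_lcm// /maxn; case: ifP => _.
- exact: ((rds_mem_log e n0).1 eA).2.
- exact: ((rds_mem_log d n0).1 dA).2.
Qed.

(** This is associativity of the convolution at the level of index sets: both sides describe the
    same factorisations of [n] into three factors. *)
Lemma rds_assoc n c e : 0 < n -> 0 < c -> 0 < e ->
  (c * e \in A n) && (e \in A (c * e)) = (c \in A n) && (e \in A (n %/ c)).
Proof.
move=> n0 c0 e0; apply/andP/andP => -[].
- move=> ceA eA; have ce0 : 0 < c * e by rewrite muln_gt0 c0.
  have cA : c \in A n.
    have := rds_codiv ce0 eA; rewrite mulnK// (rds_mem_sub _ n0 ceA).
    by case/andP.
  split=> //; rewrite (rds_mem_sub _ n0 (rds_codiv n0 cA)).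
  move: eA; rewrite (rds_mem_sub _ n0 ceA) => /andP[-> _] /=.
  by rewrite dvdn_divRL ?(rds_dvd hA n0 cA)// mulnC (rds_dvd hA n0 ceA).
- move=> cA eA; have cn := rds_dvd hA n0 cA.
  have nc0 : 0 < n %/ c by rewrite divn_gt0// dvdn_leq.
  have ncA := rds_codiv n0 cA.
  have eAn : e \in A n.
    by move: eA; rewrite (rds_mem_sub _ n0 ncA) => /andP[].
  have ceA : c * e \in A n.
    (* The complement of [e] in [n %/ c] is [n %/ (c * e)], whose complement in [n] is [c * e]. *)
    have := rds_codiv nc0 eA; rewrite (rds_mem_sub _ n0 ncA) -divnMA.
    case/andP => /(rds_codiv n0); rewrite divnA ?mulKn//.
    by rewrite mulnC -dvdn_divRL// (rds_dvd hA nc0 eA).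
  by split=> //; rewrite (rds_mem_sub _ n0 ceA) eAn dvdn_mull.
Qed.

(** The maximum is either the empty value [0] or a candidate, and the candidate [1] excludes [0]. *)
Lemma Agcd_mem_dvd n k : 0 < n ->
  Agcd A k%:Z n \in A n /\ Agcd A k%:Z n %| k.
Proof.
move=> n0.
have : Agcd A k%:Z n = 0 \/ Agcd A k%:Z n \in A n /\ Agcd A k%:Z n %| k.
  rewrite /Agcd big_seq_cond;
  apply: (big_ind (fun g => g = 0 \/ g \in A n /\ g %| k)); first by left.
  - by move=> x y Hx Hy; rewrite /maxn; case: ifP.
  - by move=> d /andP[dA dk]; right.
case=> // g0; have := @leq_bigmax_seq _ (enum_fset (A n))
  (fun d : nat => (d %| k%:Z)%Z) id 1.
by rewrite -/(Agcd A k%:Z n) g0 rds_mem1 // => /(_ isT (dvd1n k)).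
Qed.

(** The lcm of the gcd with any [d \in A n] dividing [k] is again a candidate, so by maximality it
    equals the gcd. *)
Lemma rds_Agcd n k : 0 < n ->
  A (Agcd A k%:Z n) = [fset d in A n | d %| k]%fset.
Proof.
move=> n0; have [gA gk] := Agcd_mem_dvd k n0.
apply/fsetP => d; rewrite !inE (rds_mem_sub _ n0 gA) /=.
case: (boolP (d \in A n)) => //= dA; apply/idP/idP => [dg|dk].
  exact: dvdn_trans dg gk.
have lA := rds_lcm n0 dA gA.
have : lcmn d (Agcd A k%:Z n) <= Agcd A k%:Z n.
  by apply: (@leq_bigmax_seq _ _ _ id) => //;
    change (lcmn d (Agcd A k%:Z n) %| k); rewrite dvdn_lcm dk.
move=> le; have -> : Agcd A k%:Z n = lcmn d (Agcd A k%:Z n).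
  apply/eqP; rewrite eqn_leq le andbT dvdn_leq ?dvdn_lcmr//.
  exact: rds_gt0 lA.
exact: dvdn_lcml.
Qed.

End RegularDivisorSystem.

(** * The convolution, existence of its Moebius function, and Moebius inversion *)

Section AConvolution.
Variables (A : nat -> {fset nat}) (hA : regular_divisor_system A).

Lemma perm_rds_codiv n : (0 < n)%N ->
  perm_eq (A n) [seq (n %/ d)%N | d <- A n].
Proof.
move=> n0; have invol d : d \in A n -> (n %/ (n %/ d))%N = d.
  by move=> dA; rewrite divnA ?(rds_dvd hA) // mulKn.
apply: uniq_perm; first exact: fset_uniq.
  rewrite map_inj_in_uniq ?fset_uniq // => x y xA yA e.
  by rewrite -(invol x) // e invol.
move=> d; apply/idP/mapP => [dA|[e eA ->]]; last exact: rds_codiv.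
by exists (n %/ d)%N; rewrite ?invol //; exact: rds_codiv.
Qed.

(** Substitution [d = c * e] for fixed [e], used to regroup the double sum in Moebius inversion. *)
Lemma perm_rds_mul n e : (0 < n)%N -> (0 < e)%N ->
  perm_eq [seq d <- A n | e \in A d]
          [seq (c * e)%N | c <- [seq c <- A n | e \in A (n %/ c)%N]].
Proof.
move=> n0 e0; apply: uniq_perm; first by rewrite filter_uniq ?fset_uniq.
  rewrite map_inj_in_uniq ?filter_uniq ?fset_uniq // => x y _ _ /eqP.
  by rewrite eqn_pmul2r // => /eqP.
move=> d; rewrite mem_filter andbC; apply/andP/mapP => [[dA eA]|[c]].
- have d0 := rds_gt0 hA n0 dA.
  have ed := rds_dvd hA d0 eA.
  exists (d %/ e)%N; last by rewrite divnK.
  have de0 : (0 < d %/ e)%N by rewrite divn_gt0 // dvdn_leq.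
  by rewrite mem_filter andbC -(rds_assoc hA n0 de0 e0) divnK // dA.
- rewrite mem_filter andbC => /andP[cA eA] ->; apply/andP.
  by rewrite (rds_assoc hA n0 (rds_gt0 hA n0 cA) e0) cA.
Qed.

Variable R : realType.
Implicit Types f g : nat -> R[i].

(** A range independent of [d] allows double sums to be exchanged. *)
Lemma sum_rds_sub f n d : (0 < n)%N -> d \in A n ->
  \sum_(e <- A d) f e = \sum_(e <- A n | e \in A d) f e.
Proof.
move=> n0 dA; rewrite -[RHS]big_filter; apply: perm_big; apply: uniq_perm.
- exact: fset_uniq.
- by rewrite filter_uniq ?fset_uniq.
- move=> e; rewrite mem_filter (rds_mem_sub hA _ n0 dA).
  by case: (e \in A n) => //=; rewrite ?andbT ?andbF.
Qed.

Lemma AconvC f g n : (0 < n)%N -> Aconv A f g n = Aconv A g f n.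
Proof.
move=> n0; rewrite /Aconv (perm_big _ (perm_rds_codiv n0)) big_map.
rewrite !big_seq; apply: eq_bigr => d dA.
by rewrite divnA ?(rds_dvd hA) // mulKn // mulrC.
Qed.

(* For [n <= fuel], [g := mu_rec fuel] solves
   [\sum_(d <- A n) g d = (n == 1)]. *)
Fixpoint mu_rec fuel n : R[i] :=
  if fuel is fuel'.+1 then
    (n == 1%N)%:R - \sum_(d <- A n | (d < n)%N) mu_rec fuel' d
  else 0.

(** Recursive calls go to [d < n] only, so fuel beyond [n] is never reached. *)
Lemma mu_rec_fuel n k : (0 < n <= k)%N -> mu_rec k n = mu_rec n n.
Proof.
elim/ltn_ind: n k => -[//|n] IH [//|k] nk /=; congr (_ - _).
rewrite big_seq_cond [RHS]big_seq_cond; apply: eq_bigr => d /andP[dA dn].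
have d0 := rds_gt0 hA (ltn0Sn n) dA.
by rewrite IH ?d0 1?[RHS]IH ?d0 //= (leq_trans _ (_ : n <= k)%N).
Qed.

Lemma Ainverse_exists : exists g, Ainverse A (fun=> 1 : R[i]) g.
Proof.
exists (fun n => mu_rec n n) => n n0.
suff H : Aconv A (fun n => mu_rec n n) (fun=> 1) n = (n == 1%N)%:R.
  by rewrite AconvC.
rewrite /Aconv; under eq_bigr do rewrite mulr1.
(* The only term not below [n] is [d = n]; unfolding it once cancels all the others. *)
rewrite (bigID (fun d => d < n)%N) /= addrC.
have -> : \sum_(d <- A n | ~~ (d < n)%N) mu_rec d d = mu_rec n n.
  rewrite -big_filter (perm_big [:: n]) ?big_seq1 //.
  apply: uniq_perm => //; first by rewrite filter_uniq ?fset_uniq.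
  move=> d; rewrite mem_filter inE -leqNgt; apply/andP/eqP => [[nd dA]|->].
    by apply/eqP; rewrite eqn_leq nd dvdn_leq ?(rds_dvd hA).
  by rewrite leqnn rds_id.
case: n n0 => // n _ /=; rewrite -[RHS]addr0 -addrA; congr (_ + _).
apply/eqP; rewrite addrC subr_eq0; apply/eqP.
rewrite big_seq_cond [RHS]big_seq_cond; apply: eq_bigr => d /andP[dA dn].
by rewrite [RHS]mu_rec_fuel // (rds_gt0 hA _ dA).
Qed.

Lemma sum_Amu n : (0 < n)%N -> \sum_(d <- A n) Amu R A d = (n == 1%N)%:R.
Proof.
(* As an inverse exists, the choice in [Amu] returns one rather than its default. *)
move=> n0; have /(_ n n0)[_ <-] := xgetPex (fun=> 0 : R[i]) Ainverse_exists.
by apply: eq_bigr => d _; rewrite mulr1.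
Qed.

(** Regrouping as [(1 * mu) * f], with [*] the convolution, leaves as coefficient of [f c] the sum
    of [mu] over [A (n %/ c)], which vanishes unless [c = n]. *)
Lemma Amobius_inversion f n : (0 < n)%N ->
  \sum_(d <- A n) Aconv A (Amu R A) f d = f n.
Proof.
move=> n0; rewrite big_seq /Aconv.
under eq_bigr => d dA do rewrite (sum_rds_sub _ n0 dA).
rewrite -big_seq (exchange_big_dep xpredT) //=.
transitivity (\sum_(e <- A n) \sum_(c <- A n | e \in A (n %/ c)%N)
    Amu R A e * f c).
  rewrite big_seq [RHS]big_seq; apply: eq_bigr => e eA.
  have e0 := rds_gt0 hA n0 eA.
  rewrite -big_filter (perm_big _ (perm_rds_mul n0 e0)) big_map big_filter.
  by apply: eq_bigr => c _; rewrite mulnK.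
rewrite (exchange_big_dep xpredT) //=.
transitivity (\sum_(c <- A n) (n %/ c == 1)%N%:R * f c).
  rewrite big_seq [RHS]big_seq; apply: eq_bigr => c cA.
  rewrite -mulr_suml -(sum_rds_sub _ n0 (rds_codiv hA n0 cA)) sum_Amu //.
  by rewrite divn_gt0 ?(rds_gt0 hA n0 cA) // dvdn_leq ?(rds_dvd hA).
rewrite (big_fsetD1 n) ?rds_id //= divnn n0 mul1r big_seq big1 ?addr0 // => c.
rewrite !inE => /andP[cn cA]; case: eqP => [e|_]; last by rewrite mul0r.
move: (divnK (rds_dvd hA n0 cA)); rewrite e mul1n => cE.
by rewrite cE eqxx in cn.
Qed.

End AConvolution.

(** * Geometric sums of roots of unity, and primitivity of [zeta] *)

Section RootsOfUnity.

Lemma sum_prim_root_dvd (F : fieldType) (z : F) (n d k : nat) :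
  n.-primitive_root z -> (d %| n)%N ->
  \sum_(1 <= j < n.+1 | (d %| j)%N) z ^+ (j * k) =
  (if (n %/ d %| k)%N then (n %/ d)%:R else 0).
Proof.
move=> zn dn; have n0 := prim_order_gt0 zn; have d0 := dvdn_gt0 n0 dn.
rewrite -big_filter.
have multiples : perm_eq [seq j <- index_iota 1 n.+1 | (d %| j)%N]
    [seq (i * d)%N | i <- index_iota 1 (n %/ d).+1].
  apply: uniq_perm; first by rewrite filter_uniq ?iota_uniq.
    rewrite map_inj_in_uniq ?iota_uniq // => x y _ _ /eqP.
    by rewrite eqn_pmul2r // => /eqP.
  move=> j; rewrite mem_filter mem_index_iota ltnS.
  apply/andP/mapP => [[dj /andP[j0 jn]]|[m]].
    exists (j %/ d)%N; last by rewrite divnK.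
    by rewrite mem_index_iota ltnS leq_div2r // andbT divn_gt0 // dvdn_leq.
  rewrite mem_index_iota ltnS => /andP[m0 md] ->.
  by rewrite dvdn_mull // muln_gt0 m0 d0 -leq_divRL.
(* The index starts at 1; shifting it to 0 costs one factor [x], pulled out below. *)
rewrite (perm_big _ multiples) big_map big_add1 big_mkord /=.
under eq_bigr => i _ do rewrite -mulnA mulnC exprM exprS.
rewrite -mulr_sumr; set x := z ^+ (d * k).
have -> : (n %/ d %| k)%N = (x == 1).
  by rewrite -(prim_order_dvd zn) -{2}(divnK dn) mulnC dvdn_pmul2l.
case: eqP => [->|/eqP x1].
  by under eq_bigr do rewrite expr1n; rewrite sumr_const card_ord mul1r.
(* The product telescopes to [x ^+ (n %/ d) - 1], and [z ^+ n = 1]. *)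
suff /eqP : (x - 1) * \sum_(i < n %/ d) x ^+ i = 0.
  by rewrite mulf_eq0 subr_eq0 (negbTE x1) /= => /eqP->; rewrite mulr0.
rewrite -subrX1 -exprM mulnAC [X in (X * k)%N]mulnC divnK // exprM.
by rewrite (prim_expr_order zn) expr1n subrr.
Qed.

Variable R : realType.

(** De Moivre's formula, which reduces the order of [zeta] to real trigonometry. *)
Lemma zetaX n m : zeta R n ^+ m =
  (cos (pi *+ 2 * m%:R / n%:R) +i* sin (pi *+ 2 * m%:R / n%:R))%C.
Proof.
have -> : zeta R n = (cos (pi *+ 2 / n%:R) +i* sin (pi *+ 2 / n%:R))%C.
  rewrite /zeta.
  have -> : 2 * (pi : R)%:C%C * 'i%C / n%:R = (0 +i* (pi *+ 2 / n%:R))%C.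
    have -> : (n%:R : R[i]) = (n%:R)%:C%C by rewrite rmorph_nat.
    rewrite mulr_natl -rmorphMn /= -fmorphV mulrAC -rmorphM.
    apply/eqP; rewrite eq_complex /=.
    by rewrite !(mul0r, mulr0, mulr1, addr0, subr0, oppr0, add0r) !eqxx.
  by rewrite /Cexp /= expR0 mul1r.
elim: m => [|m IH]; first by rewrite expr0 mulr0 mul0r cos0 sin0.
rewrite exprS IH -[in RHS]natr1 mulrDr mulr1 mulrDl addrC cosD sinD.
by apply/eqP; rewrite eq_complex /= eqxx /= addrC.
Qed.

(** If the order [m] were below [n], the half-angle [x = pi * m / n] would lie strictly between 0
    and [pi], so [sin x > 0], while [cos (2 x) = 1] forces [sin x = 0]. *)
Lemma zeta_prim_root n : (0 < n)%N -> n.-primitive_root (zeta R n).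
Proof.
move=> n0; have nR : (n%:R : R) != 0 by rewrite pnatr_eq0 -lt0n.
have zn : zeta R n ^+ n = 1 by rewrite zetaX mulfK // cos2pi sin2pi.
have [m zm mn] := prim_order_exists n0 zn.
have m0 := prim_order_gt0 zm.
have := dvdn_leq n0 mn; rewrite leq_eqVlt => /orP[/eqP mE|ltmn].
  by rewrite -{1}mE.
have := prim_expr_order zm; rewrite zetaX => /(congr1 (@complex.Re R)) /=.
pose x : R := pi * m%:R / n%:R.
have -> : pi *+ 2 * m%:R / n%:R = x *+ 2 by rewrite /x !mulrnAl.
have : 0 < sin x.
  apply: sin_gt0_pi; rewrite /x -mulrA pmulr_rgt0 ?pi_gt0 // divr_gt0 ?ltr0n //=.
  by rewrite gtr_pMr ?pi_gt0 // ltr_pdivrMr ?ltr0n // mul1r ltr_nat.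
rewrite cos_mulr2n cos2sin2 => s0 /eqP.
rewrite mulrnBl mulr2n addrAC addrK subr_eq addrC -subr_eq subrr eq_sym.
by rewrite mulrn_eq0 /= sqrf_eq0 gt_eqF.
Qed.

End RootsOfUnity.

(** * The Fourier transform of a function of the [A]-gcd *)

Theorem theorem5 (R : realType) (A : nat -> {fset nat})
    (hA : regular_divisor_system A) (f : nat -> R[i]) (n k : nat)
    (hn : (0 < n)%N) (hk : (0 < k)%N) :
  \sum_(1 <= j < n.+1) f (Agcd A j%:Z n) * zeta R n ^+ (j * k)%N
    = \sum_(d <- A (Agcd A k%:Z n)) d%:R * Aconv A (Amu R A) f (n %/ d)%N
  /\ A (Agcd A k%:Z n) = [fset d in A n | (d %| k)%N]%fset.
Proof.
split; last exact: rds_Agcd.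
pose F := Aconv A (Amu R A) f.
transitivity (\sum_(1 <= j < n.+1) \sum_(d <- A n | (d %| j)%N)
    F d * zeta R n ^+ (j * k)).
  apply: eq_bigr => j _; rewrite -mulr_suml; congr (_ * _).
  have g0 := rds_gt0 hA hn (Agcd_mem_dvd hA j hn).1.
  by rewrite -(Amobius_inversion hA f g0) (rds_Agcd hA _ hn) -big_fset_condE.
rewrite (exchange_big_dep xpredT) //= rds_Agcd // -big_fset_condE.
transitivity (\sum_(d <- A n)
    F d * (if (n %/ d %| k)%N then (n %/ d)%:R else 0)).
  rewrite big_seq [RHS]big_seq; apply: eq_bigr => d dA.
  rewrite -mulr_sumr (sum_prim_root_dvd _ (zeta_prim_root _ hn)) //.
  exact: rds_dvd dA.
(* Passing to complements turns the condition on [n %/ d] into [d %| k] and the weight into [d]. *)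
rewrite (perm_big _ (perm_rds_codiv hA hn)) big_map [RHS]big_mkcond.
rewrite big_seq [RHS]big_seq; apply: eq_bigr => d dA.
rewrite divnA; last exact: rds_dvd dA.
rewrite mulKn //.
by case: ifP => _; rewrite ?mulr0 // mulrC.
Qed.
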